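(* Let $\pi : (M, g_0) \rightarrow (N, g_N)$ be a Riemannian submersion. A variation $\{ g_t, t \in (-\epsilon, \epsilon) \} \subset \mathrm{Riem}(M, \mathcal{V}, g_0)$ preserves the Riemannian submersion $\pi$ if and only if for all $t \in (-\epsilon, \epsilon)$ $$B_t(X,Y) = B_t(P_{\mathcal{H}}^t X , P_{\mathcal{V}}^t Y ) + B_t(P_{\mathcal{H}}^t Y, P_{\mathcal{V}}^t X) \quad \text{for all } X,Y \in \mathfrak{X}_{M}.$$
   Context: Manifolds are smooth, connected and oriented; all functions and tensor fields are smooth. $\mathfrak{X}_M$ is the set of vector fields on $M$. A Riemannian submersion $\pi:(M,g)\to(N,g_N)$ is a smooth map with $\operatorname{rank}\pi_*=\dim N$ and $g(X,Y)=g_N(\pi_*X,\pi_*Y)$ for all $X,Y$ that are $g$-orthogonal to $\ker\pi_*$. $\mathcal{V}=\ker\pi_*$ is the vertical distribution. $\mathrm{Riem}(M,\mathcal{V},g_0)$ is the set of Riemannian metrics $g$ on $M$ with $g(X,Y)=g_0(X,Y)$ for all vector fields $X,Y$ with values in $\mathcal{V}$. A variation of $g_0$ is a one-parameter family $\{g_t, t\in(-\epsilon,\epsilon)\}\subset \mathrm{Riem}(M,\mathcal{V},g_0)$ depending smoothly on $t$, whose member at $t=0$ is $g_0$. It preserves the Riemannian submersion $\pi$ if $\pi:(M,g_t)\to(N,g_N)$ is a Riemannian submersion for all $t\in(-\epsilon,\epsilon)$. $\mathcal{H}(t)$ is the $g_t$-orthogonal complement of $\mathcal{V}$; $P_{\mathcal{V}}^t$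 and $P_{\mathcal{H}}^t$ are the $g_t$-orthogonal projections onto $\mathcal{V}$ and $\mathcal{H}(t)$; $B_t=\partial_t g_t$. *)

(* Defs.v *)
From HB Require Import structures.
From mathcomp Require Import all_boot all_order all_algebra.
From mathcomp Require Import all_classical all_reals all_analysis.
Set Implicit Arguments.
Unset Strict Implicit.
Unset Printing Implicit Defensive.
Import Order.TTheory GRing.Theory Num.Theory.
Import numFieldNormedType.Exports.
Local Open Scope classical_set_scope.
Local Open Scope ring_scope.

(* Meant for open U and finite-dimensional V, where it is the usual C^k. *)
Fixpoint Ck_on (R : realType) (V W : normedModType R) (k : nat) (U : set V)
    (f : V -> W) : Prop :=
  if k is k'.+1 then
    (forall x, U x -> differentiable f x) /\
    (forall v : V, Ck_on k' U (fun x => 'D_v f x))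
  else forall x, U x -> {for x, continuous f}.

Definition smooth_on (R : realType) (V W : normedModType R) (U : set V)
    (f : V -> W) : Prop := forall k, Ck_on k U f.

(* [chart_fwd] and [chart_bwd] are total functions; only their restrictions
   to [chart_dom] and to its image are meaningful. *)
Record chart (R : realType) (n : nat) (T : topologicalType) := Chart {
  chart_dom : set T;
  chart_fwd : T -> 'rV[R]_n;
  chart_bwd : 'rV[R]_n -> T;
  chart_dom_open : open chart_dom;
  chart_img_open : open (chart_fwd @` chart_dom);
  chart_fwdK : forall p, chart_dom p -> chart_bwd (chart_fwd p) = p;
  chart_fwd_continuous :
    forall p, chart_dom p -> {for p, continuous chart_fwd};
  chart_bwd_continuous :
    forall x, (chart_fwd @` chart_dom) x -> {for x, continuous chart_bwd}
}.

Definition chart_img (R : realType) (n : nat) (T : topologicalType)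
    (c : chart R n T) : set 'rV[R]_n := chart_fwd c @` chart_dom c.

(* The differential at p of the transition map from c to d: it turns the
   components of a tangent vector at p in c into its components in d. *)
Definition chart_diff (R : realType) (n : nat) (T : topologicalType)
    (c d : chart R n T) (p : T) : 'rV[R]_n -> 'rV[R]_n :=
  'd (chart_fwd d \o chart_bwd c) (chart_fwd c p).

(* Smooth, connected, oriented, Hausdorff, second countable n-manifolds.
   [chart_at p] is a distinguished chart around p. The tangent space at p is
   'rV[R]_n throughout: a tangent vector at p is given by its components in
   [chart_at p], so a vector field is a map M -> 'rV[R]_n whose smoothness has
   to be tested in the charts of the atlas.
   [orient p] says whether [chart_at p] is positively oriented at p; the last
   field makes this a continuous choice of orientations of tangent spaces. *)
Record manifold (R : realType) (n : nat) := Manifold {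
  carrier :> topologicalType;
  atlas : set (chart R n carrier);
  chart_at : carrier -> chart R n carrier;
  orient : carrier -> bool;
  manifold_hausdorff : hausdorff_space carrier;
  manifold_second_countable : @second_countable carrier;
  manifold_connected : connected [set: carrier];
  chart_at_atlas : forall p, atlas (chart_at p);
  chart_at_dom : forall p, chart_dom (chart_at p) p;
  atlas_compatible : forall c d, atlas c -> atlas d ->
    smooth_on (chart_fwd c @` (chart_dom c `&` chart_dom d))
              (chart_fwd d \o chart_bwd c);
  orient_continuous : forall p, \forall q \near p,
    orient q =
      orient p (+)
      (\det (lin1_mx (chart_diff (chart_at q) (chart_at p) q)) < 0)
}.

Arguments atlas {R n} m _.

Section Manifolds.
Context {R : realType}.

Definition smooth_map (m n : nat) (M : manifold R m) (N : manifold R n)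
    (f : M -> N) : Prop :=
  continuous f /\
  forall c d, atlas M c -> atlas N d ->
    smooth_on (chart_fwd c @` (chart_dom c `&` f @^-1` chart_dom d))
              (chart_fwd d \o f \o chart_bwd c).

Definition tangent_map (m n : nat) (M : manifold R m) (N : manifold R n)
    (f : M -> N) (p : M) : 'rV[R]_m -> 'rV[R]_n :=
  'd (chart_fwd (chart_at (f p)) \o f \o chart_bwd (chart_at p))
     (chart_fwd (chart_at p) p).

Context {n : nat} (M : manifold R n).

Record vector_field := VectorField {
  vf_val :> M -> 'rV[R]_n;
  vf_smooth : forall c, atlas M c ->
    smooth_on (chart_img c)
      (fun x => let p := chart_bwd c x in
                chart_diff (chart_at p) c p (vf_val p))
}.

(* The i-th coordinate field of the chart c, at the point of coordinates x. *)
Definition coord_vector (c : chart R n M) (x : 'rV[R]_n) (i : 'I_n) :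
    'rV[R]_n :=
  let p := chart_bwd c x in chart_diff c (chart_at p) p (delta_mx 0 i).

Definition metric_coef (g : M -> 'rV[R]_n -> 'rV[R]_n -> R)
    (c : chart R n M) (i j : 'I_n) (x : 'rV[R]_n) : R :=
  g (chart_bwd c x) (coord_vector c x i) (coord_vector c x j).

Record riemannian_metric := RiemannianMetric {
  metric_form :> M -> 'rV[R]_n -> 'rV[R]_n -> R;
  metric_linear : forall p a u v w,
    metric_form p (a *: u + v) w = a * metric_form p u w + metric_form p v w;
  metric_sym : forall p u v, metric_form p u v = metric_form p v u;
  metric_pos : forall p u, u != 0 -> 0 < metric_form p u u;
  metric_smooth : forall c, atlas M c -> forall i j,
    smooth_on (chart_img c) (metric_coef metric_form c i j)
}.

Definition orthogonal_to (g : riemannian_metric) (p : M)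
    (W : set 'rV[R]_n) : set 'rV[R]_n :=
  [set u | forall v, W v -> g p u v = 0].

(* For a linear subspace W the set below is a singleton, so that the default
   value 0 is not used. *)
Definition orth_proj (g : riemannian_metric) (p : M) (W : set 'rV[R]_n)
    (u : 'rV[R]_n) : 'rV[R]_n :=
  xget 0 [set w | W w /\ orthogonal_to g p W (u - w)].

End Manifolds.

Section Submersions.
Context {R : realType} {m n : nat} {M : manifold R m} {N : manifold R n}.
Variable f : M -> N.

Definition vertical (p : M) : set 'rV[R]_m :=
  [set u | tangent_map f p u = 0].

Definition horizontal (g : riemannian_metric M) (p : M) : set 'rV[R]_m :=
  orthogonal_to g p (vertical p).

Definition vert_proj (g : riemannian_metric M) (p : M) :
    'rV[R]_m -> 'rV[R]_m := orth_proj g p (vertical p).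

Definition hor_proj (g : riemannian_metric M) (p : M) :
    'rV[R]_m -> 'rV[R]_m := orth_proj g p (horizontal g p).

Definition riemannian_submersion (g : riemannian_metric M)
    (gN : riemannian_metric N) : Prop :=
  [/\ smooth_map f,
      forall p, \rank (lin1_mx (tangent_map f p)) = n &
      forall p u v, horizontal g p u -> horizontal g p v ->
        g p u v = gN (f p) (tangent_map f p u) (tangent_map f p v)].

Definition Riem (g0 : riemannian_metric M) : set (riemannian_metric M) :=
  [set g | forall X Y : vector_field M,
     (forall p, vertical p (X p)) -> (forall p, vertical p (Y p)) ->
     forall p, g p (X p) (Y p) = g0 p (X p) (Y p)].

(* Only the values of g on ]-eps, eps[ matter. The family is smooth in t and
   in the point of M jointly. *)
Definition is_variation (g0 : riemannian_metric M) (eps : R)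
    (g : R -> riemannian_metric M) : Prop :=
  [/\ 0 < eps,
      forall t, - eps < t < eps -> Riem g0 (g t),
      forall c, atlas M c -> forall i j,
        smooth_on [set tx : R * 'rV[R]_m | - eps < tx.1 < eps /\
                                           chart_img c tx.2]
                  (fun tx => metric_coef (g tx.1) c i j tx.2 : R) &
      forall p u v, g 0 p u v = g0 p u v].

Definition preserves_submersion (gN : riemannian_metric N) (eps : R)
    (g : R -> riemannian_metric M) : Prop :=
  forall t, - eps < t < eps -> riemannian_submersion (g t) gN.

End Submersions.

(* The tensor B_t, the derivative of g_t with respect to t. *)
Definition variation_deriv (R : realType) (m : nat) (M : manifold R m)
    (g : R -> riemannian_metric M) (t : R) (p : M) (u v : 'rV[R]_m) : R :=
  derive1 (fun s : R => g s p u v) t.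

(* Main.v *)
(* All the metrics g_t agree on V, so a pair of frames (a_i), (b_i) of V at a
   point that are dual for g_0 is dual for every g_t, and
   P_V^t u = sum_i g_t(u, a_i) b_i. Therefore
     g_t(P_H^t u, P_H^t v) = g_t(u, v) - sum_i g_t(v, a_i) g_t(u, b_i),
   whose derivative in t is B_t(u, v) - B_t(u, P_V^t v) - B_t(v, P_V^t u).
   Since B_t vanishes on V x V, this is the defect of the identity to be
   characterized. On the other hand the differential of the submersion takes
   the same value at u and at P_H^t u, so that the submersion is preserved iff
   the left-hand side does not depend on t.
   Vectors and vector fields are related by extending a vector (resp. a
   vertical vector) to a global field (resp. vertical field) with a bump
   function. *)
Require Import Defs.
From mathcomp Require Import all_boot all_order all_algebra.
From mathcomp Require Import all_classical all_reals all_analysis.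
From mathcomp Require Import ring lra.
Set Implicit Arguments.
Unset Strict Implicit.
Unset Printing Implicit Defensive.
Import Order.TTheory GRing.Theory Num.Theory.
Import numFieldNormedType.Exports.
Local Open Scope classical_set_scope.
Local Open Scope ring_scope.

(** * Functions of class C^k *)

Section Ck_calculus.
Context {R : realType} {V : normedModType R}.

Section Ck_general.
Context {W : normedModType R}.
Implicit Types (U : set V) (f g : V -> W) (k : nat).

(** The first-order expansion of f at x only involves values near x, so g has the same one;
    uniqueness of the differential concludes. *)
Lemma near_eq_diff f g (x : V) : (\near x, f x = g x) ->
  differentiable f x -> differentiable g x /\ 'd g x = 'd f x :> (V -> W).
Proof.
move=> fg df; have [dc /eqaddoP fE] := (diff_locallyP x f).1 df.
have fgx := nbhs_singleton fg.
have gE : g \o shift x = cst (g x) + 'd f x +o_ 0 id.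
  apply/eqaddoP => e e0; have := fE e e0.
  have : \forall y \near 0, f (y + x) = g (y + x).
    by move: fg; rewrite (near_shift 0)/= subr0.
  apply: filterS2 => y fgy; rewrite /= /shift /cst /= !fctE.
  by rewrite -fgy -fgx.
have dg := diff_unique dc gE.
split; last exact: dg.
by apply/diff_locallyP; split; rewrite dg.
Qed.

Lemma open_near_eq U f g x : open U -> U x -> (forall y, U y -> f y = g y) ->
  \near x, f x = g x.
Proof.
by move=> oU Ux fg; apply: filterS (open_nbhs_nbhs (conj oU Ux)).
Qed.

(** Openness of U lets equality on U pass to directional derivatives, which are taken of the total
    functions. *)
Lemma Ck_on_eq k U f g : open U -> (forall x, U x -> f x = g x) ->
  Ck_on k U f -> Ck_on k U g.
Proof.
move=> oU; elim: k => [|k IHk] in f g *.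
  move=> fg fc x Ux; have nfg := open_near_eq oU Ux fg.
  rewrite /prop_for/= /continuous_at -(fg _ Ux).
  by apply: cvg_trans (fc x Ux); apply: near_eq_cvg; exact: nfg.
move=> fg [df Df]; split=> [x Ux|v].
  exact: (near_eq_diff (open_near_eq oU Ux fg) (df x Ux)).1.
apply: IHk (Df v) => x Ux; apply: near_eq_derive.
exact: open_near_eq oU Ux fg.
Qed.

Lemma Ck_on_local k U f :
  (forall x, U x -> exists2 U', U' x & Ck_on k U' f) -> Ck_on k U f.
Proof.
elim: k => [|k IHk] in f *.
  by move=> Uf x /Uf[U' U'x fc]; exact: fc.
move=> Uf; split=> [x /Uf[U' U'x [df _]]|v]; first exact: df.
by apply: IHk => x /Uf[U' U'x [_ Df]]; exists U' => //; exact: Df.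
Qed.

Lemma Ck_on_sub k U U' f : U' `<=` U -> Ck_on k U f -> Ck_on k U' f.
Proof. by move=> sU Uf; apply: Ck_on_local => x /sU Ux; exists U. Qed.

Lemma Ck_onS k U f : Ck_on k.+1 U f -> Ck_on k U f.
Proof.
elim: k => [|k IHk] in f *.
  by move=> [df _] x Ux; exact: differentiable_continuous (df x Ux).
by move=> [df Df]; split=> // v; apply: IHk; exact: Df.
Qed.

Lemma Ck_on_cst k U (a : W) : Ck_on k U (fun=> a).
Proof.
elim: k a => [|k IHk] a; first by move=> x _; exact: cst_continuous.
split=> [x _|v]; first exact: differentiable_cst.
have -> : (fun x => 'D_v (fun=> a) x) = (fun _ : V => 0 : W).
  by apply/funext => x; rewrite (derive_cst a).
exact: IHk.
Qed.

End Ck_general.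

Implicit Types (U : set V) (f g : V -> R) (k : nat).

Lemma Ck_onD k U f g : open U -> Ck_on k U f -> Ck_on k U g ->
  Ck_on k U (fun x => f x + g x).
Proof.
move=> oU; elim: k => [|k IHk] in f g *.
  by move=> fc gc x Ux; apply: cvgD; [exact: fc|exact: gc].
move=> [df Df] [dg Dg]; split=> [x Ux|v].
  by apply: differentiableD; [exact: df|exact: dg].
apply: (Ck_on_eq (f := fun x => 'D_v f x + 'D_v g x)) => // [x Ux|].
  by rewrite deriveD//; apply: diff_derivable; [exact: df|exact: dg].
exact: IHk (Df v) (Dg v).
Qed.

Lemma Ck_onM k U f g : open U -> Ck_on k U f -> Ck_on k U g ->
  Ck_on k U (fun x => f x * g x).
Proof.
move=> oU; elim: k => [|k IHk] in f g *.
  by move=> fc gc x Ux; apply: cvgM; [exact: fc|exact: gc].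
move=> fk gk; have [df Df] := fk; have [dg Dg] := gk; split=> [x Ux|v].
  by apply: differentiableM; [exact: df|exact: dg].
apply: (Ck_on_eq (f := fun x => f x * 'D_v g x + g x * 'D_v f x)) => // [x Ux|].
  by rewrite deriveM//; apply: diff_derivable; [exact: df|exact: dg].
by apply: Ck_onD => //; [exact: IHk (Ck_onS fk) (Dg v)|
                         exact: IHk (Ck_onS gk) (Df v)].
Qed.

Lemma Ck_on_sum k U (I : Type) (r : seq I) (P : pred I) (F : I -> V -> R) :
  open U -> (forall i, Ck_on k U (F i)) ->
  Ck_on k U (fun x => \sum_(i <- r | P i) F i x).
Proof.
move=> oU FU; elim: r => [|i r IHr].
  by under eq_fun do rewrite big_nil; exact: Ck_on_cst.
under eq_fun do rewrite big_cons; case: (P i) => //; exact: Ck_onD.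
Qed.

Lemma Ck_on_prod k U (I : Type) (r : seq I) (P : pred I) (F : I -> V -> R) :
  open U -> (forall i, Ck_on k U (F i)) ->
  Ck_on k U (fun x => \prod_(i <- r | P i) F i x).
Proof.
move=> oU FU; elim: r => [|i r IHr].
  by under eq_fun do rewrite big_nil; exact: Ck_on_cst.
under eq_fun do rewrite big_cons; case: (P i) => //; exact: Ck_onM.
Qed.

Lemma differentiable_rV n (F : V -> 'rV[R]_n) x :
  (forall i, differentiable (fun y => F y 0 i : R) x) -> differentiable F x.
Proof.
move=> dF; rewrite (_ : F = \sum_(i < n) (fun y => F y 0 i *: delta_mx 0 i)).
  by apply: differentiable_sum => i; exact: differentiableZl.
by apply/funext => y; rewrite fct_sumE -row_sum_delta.
Qed.

Lemma derive_rV n (F : V -> 'rV[R]_n) x v i : differentiable F x ->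
  ('D_v F x) 0 i = 'D_v (fun y => F y 0 i : R) x.
Proof. by move=> dF; rewrite derive_mx ?mxE//; exact: diff_derivable. Qed.

Lemma Ck_on_rV k U n (F : V -> 'rV[R]_n) : open U ->
  (forall i, Ck_on k U (fun x => F x 0 i : R)) -> Ck_on k U F.
Proof.
move=> oU; elim: k => [|k IHk] in F *.
  move=> Fc x Ux; apply/cvgrPdist_le => e e0; near=> y.
  rewrite /Num.Def.normr/= mx_normrE (bigmax_le _ (ltW e0))//= => -[i j] _.
  rewrite !mxE/= ord1; move: j; near: y; apply: filter_forall => j.
  exact: ((cvgrPdist_le _ _).1 (Fc j x Ux)).
move=> Fk; have dF x : U x -> differentiable F x.
  by move=> Ux; apply: differentiable_rV => i; exact: (Fk i).1.
split=> // v; apply: IHk => i.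
apply: Ck_on_eq ((Fk i).2 v) => // x Ux.
by rewrite derive_rV//; exact: dF.
Unshelve. all: by end_near. Qed.

Lemma Ck_on_coord k U n (F : V -> 'rV[R]_n) i : open U ->
  Ck_on k U F -> Ck_on k U (fun x => F x 0 i : R).
Proof.
move=> oU; elim: k => [|k IHk] in F *.
  move=> Fc x Ux.
  exact: (continuous_comp (Fc x Ux) (@coord_continuous _ _ _ 0 i (F x))).
move=> [dF DF]; split=> [x Ux|v].
  exact: (differentiable_comp (dF x Ux) (differentiable_coord (F x) 0 i)).
apply: Ck_on_eq (IHk _ (DF v)) => // x Ux.
by rewrite derive_rV//; exact: dF.
Qed.

(** Chain rule by induction: D_v (g o F) is the sum of c_i (D_v F) times (D_(e_i) g) o F, so g is
    only differentiated in constant directions, as in [Ck_on]. Keeping the basis e and its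
    coordinates c abstract covers both row vectors and R. *)
Lemma Ck_on_comp_basis k U (Y : normedModType R) (U' : set Y) n
    (e : 'I_n -> Y) (c : 'I_n -> Y -> R) (F : V -> Y) (g : Y -> R) :
  (forall y, y = \sum_i c i y *: e i) ->
  (forall k (f : V -> Y) i, Ck_on k U f -> Ck_on k U (fun x => c i (f x))) ->
  open U -> (forall x, U x -> U' (F x)) -> Ck_on k U F -> Ck_on k U' g ->
  Ck_on k U (g \o F).
Proof.
move=> ec cC oU UF; elim: k => [|k IHk] in g *.
  move=> Fc gc x Ux; apply: continuous_comp; first exact: Fc.
  by apply: gc; exact: UF.
move=> Fk gk; have [dF DF] := Fk; have [dg Dg] := gk; split=> [x Ux|v].
  by apply: differentiable_comp; [exact: dF|apply: dg; exact: UF].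
apply: (Ck_on_eq (f := fun x =>
  \sum_(i < n) c i ('D_v F x) * 'D_(e i) g (F x))) => // [x Ux|].
  have dFx := dF x Ux; have dgx := dg _ (UF x Ux).
  rewrite (deriveE v (differentiable_comp dFx dgx)) (diff_comp dFx dgx) /=.
  rewrite -(deriveE v dFx) [in RHS](ec ('D_v F x)) linear_sum.
  by apply: eq_bigr => i _; rewrite linearZ (deriveE (e i) dgx).
apply: Ck_on_sum => // i; apply: Ck_onM => //; first exact: cC (DF v).
exact: (IHk (fun y => 'D_(e i) g y)) (Ck_onS Fk) (Dg _).
Qed.

Lemma Ck_on_comp_rV k U n (U' : set 'rV[R]_n) (F : V -> 'rV[R]_n)
    (g : 'rV[R]_n -> R) :
  open U -> (forall x, U x -> U' (F x)) -> Ck_on k U F -> Ck_on k U' g ->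
  Ck_on k U (g \o F).
Proof.
move=> oU.
apply: (Ck_on_comp_basis (e := fun i => 'e_i)
  (c := fun i (y : 'rV_n) => y 0 i)).
- exact: row_sum_delta.
- by move=> k' f i; exact: Ck_on_coord.
- exact: oU.
Qed.

Lemma Ck_on_comp k U (U' : set R) f (g : R -> R) :
  open U -> (forall x, U x -> U' (f x)) -> Ck_on k U f -> Ck_on k U' g ->
  Ck_on k U (g \o f).
Proof.
move=> oU.
apply: (Ck_on_comp_basis (e := fun i : 'I_1 => 1 : R) (c := fun i => id)).
- by move=> y; rewrite big_ord1 -[RHS]/(y * 1) mulr1.
- by [].
- exact: oU.
Qed.

End Ck_calculus.

(** * Smooth bump functions *)

Section Bump.
Context {R : realType}.

(** The flat functions exp (-1/x) / x^n, extended by 0 to x <= 0. All n are treated together because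
    differentiation shifts the index. *)
Definition flat_exp (n : nat) (x : R) : R :=
  if 0 < x then x^-1 ^+ n * expR (- x^-1) else 0.

Lemma flat_exp_ge0 n x : 0 <= flat_exp n x.
Proof.
rewrite /flat_exp; case: ltrP => // x0.
by rewrite mulr_ge0 ?expR_ge0// exprn_ge0// invr_ge0 ltW.
Qed.

(** With y = 1/x > 0 this is y^(n+2) <= (n+2)! exp y, a term of the exponential series. The square
    of x makes the difference quotient at 0 tend to 0. *)
Lemma flat_exp_le n x : flat_exp n x <= n.+2`!%:R * x ^+ 2.
Proof.
rewrite /flat_exp; case: ltrP => x0; last by rewrite mulr_ge0 ?sqr_ge0.
have y0 : 0 < x^-1 by rewrite invr_gt0.
rewrite -[x in X in _ <= X]invrK; move: x^-1 y0 => y y0.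
have := expR_ge1Dxn n.+1 (ltW y0); set c : R := n.+2`!%:R => ey.
have c0 : 0 < c by rewrite ltr0n fact_gt0.
rewrite expRN ler_pdivrMr ?expR_gt0// exprVn mulrAC ler_pdivlMr ?exprn_gt0//.
rewrite -exprD addn2 -ler_pdivrMl// mulrC; apply: le_trans ey.
by rewrite lerDr.
Qed.

Lemma is_derive_exprV_expRNV n (x : R) : 0 < x ->
  is_derive x (1 : R) (fun y : R => y^-1 ^+ n * expR (- y^-1))
    (x^-1 ^+ n * (expR (- x^-1) * x^-1 ^+ 2) +
     expR (- x^-1) * ((- x^-1 ^+ 2) * (n%:R * x^-1 ^+ n.-1))).
Proof.
move=> x0; have x0' : x != 0 by rewrite gt_eqF.
have dV : is_derive x (1 : R) (fun y : R => y^-1) (- x ^- 2).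
  apply: is_derive_eq (is_deriveV x0' (is_derive_id x (1:R))) _.
  by rewrite -[RHS]mulr1.
have dE : is_derive x (1 : R) (fun y : R => expR (- y^-1))
    (expR (- x^-1) * - - x ^- 2).
  exact: (@is_derive1_comp _ expR (fun y : R => - y^-1)).
have dX := is_deriveX n dV; rewrite exprfctE /= in dX.
apply: (is_derive_eq (is_deriveM dX dE)); rewrite opprK -exprVn.
by congr (_ + _ * _); exact: mulrC.
Qed.

Lemma growth_rate_flat_exp0 n (F := flat_exp n) :
  h^-1 *: (F (h *: 1 + 0) - F 0) @[h --> 0^'] --> (0 : R).
Proof.
have F0 : F (0:R) = 0 by rewrite /F /flat_exp ltxx.
have c0 : 0 < n.+2`!%:R :> R by rewrite ltr0n fact_gt0.
rewrite F0; apply/cvgr0Pnorm_le => e e0; near=> h.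
have h0 : 0 < `|h| by rewrite normr_gt0; near: h; exact: nbhs_dnbhs_neq.
have he : `|h| < e / n.+2`!%:R.
  by near: h; apply: dnbhs0_lt; rewrite divr_gt0.
rewrite subr0 addr0.
rewrite -[h *: 1]/(h * 1) mulr1 normrZ normfV (ger0_norm (flat_exp_ge0 _ _)).
rewrite ler_pdivrMl//; apply: le_trans (flat_exp_le _ _) _.
rewrite -real_normK ?num_real// expr2 mulrCA; apply: ler_wpM2l => //.
by rewrite -ler_pdivlMl// mulrC ltW.
Unshelve. all: by end_near. Qed.

(** The derivative is a combination of members of the same family, which yields smoothness by
    induction. At 0 all members vanish, and the quadratic bound gives derivative 0. *)
Lemma is_derive_flat_exp n x :
  is_derive x (1 : R) (flat_exp n) (flat_exp n.+2 x - n%:R * flat_exp n.+1 x).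
Proof.
have [x0|x0|->] := ltgtP x 0.
- have E k : flat_exp k x = 0 by rewrite /flat_exp ltNge ltW.
  rewrite !E mulr0 subr0.
  apply: (@near_eq_is_derive _ _ _ (cst 0)) => //.
  near=> y; rewrite /flat_exp ltNge ltW//=.
  by near: y; exact: lt_nbhsl.
- pose F (y : R) : R := y^-1 ^+ n * expR (- y^-1).
  have -> : flat_exp n.+2 x - n%:R * flat_exp n.+1 x =
     x^-1 ^+ n * (expR (- x^-1) * x^-1 ^+ 2) +
     expR (- x^-1) * ((- x^-1 ^+ 2) * (n%:R * x^-1 ^+ n.-1)).
    (* For n = 0 the exponent [n.-1] is truncated to 0, but its term carries the factor [n%:R] = 0;
       hence the case split. *)
    rewrite /flat_exp x0; case: n {F} => [|n]; rewrite ?exprS ?expr0/=; ring.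
  apply: (@near_eq_is_derive _ _ _ F).
    near=> y; rewrite /flat_exp ifT//.
    by near: y; exact: lt_nbhsr.
  exact: is_derive_exprV_expRNV.
- have E k : flat_exp k 0 = 0 by rewrite /flat_exp ltxx.
  rewrite !E mulr0 subr0.
  have H := growth_rate_flat_exp0 n.
  apply: DeriveDef.
    by apply/cvg_ex; exists 0; exact: H.
  exact: cvg_lim H.
Unshelve. all: by end_near. Qed.

Lemma Ck_on_flat_exp k n U : Ck_on k U (flat_exp n).
Proof.
apply: (@Ck_on_sub _ _ _ _ setT) => //.
have dh m x : differentiable (flat_exp m) x.
  by apply/derivable1_diffP; case: (is_derive_flat_exp m x).
elim: k n => [|k IHk] n.
  by move=> x _; exact: differentiable_continuous (dh n x).
split=> // v.
have -> : (fun x => 'D_v (flat_exp n) x) =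
  (fun x => v * (flat_exp n.+2 x + - n%:R * flat_exp n.+1 x)).
  apply/funext => x; rewrite (deriveE v (dh n x)).
  rewrite -[in LHS](mulr1 v) -[v * 1]/(v *: (1 : R)) linearZ.
  rewrite -(deriveE _ (dh n x)).
  by rewrite (@derive_val _ _ _ _ _ _ _ (is_derive_flat_exp n x)) mulNr.
apply: (Ck_onM openT (Ck_on_cst _ _ _)).
apply: (Ck_onD openT (IHk _)).
exact: (Ck_onM openT (Ck_on_cst _ _ _)) (IHk _).
Qed.

Lemma Ck_on_id k (V : normedModType R) (U : set V) : Ck_on k U (id : V -> V).
Proof.
case: k => [|k]; first by move=> x _; exact: cvg_id.
split=> [x _|v]; first exact: ex_diff.
have -> : (fun x => 'D_v id x) = (fun=> v).
  by apply/funext => x; rewrite derive_id.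
exact: Ck_on_cst.
Qed.

Lemma smooth_bump n (x0 : 'rV[R]_n) r : 0 < r ->
  exists phi : 'rV[R]_n -> R, [/\ smooth_on setT phi, phi x0 = 1 &
    forall x, phi x != 0 -> forall i, `|x 0 i - x0 0 i| < r].
Proof.
move=> r0; pose c := (flat_exp 0 r ^+ 2)^-1.
have hr : 0 < flat_exp 0 r by rewrite /flat_exp r0 expr0 mul1r expR_gt0.
(* The i-th factor is nonzero exactly where the i-th coordinate is within r of that of the centre; c
   normalizes it to 1 at the centre. *)
exists (fun x => \prod_i (c * (flat_exp 0 (r + (-1) * (x 0 i - x0 0 i)) *
                        flat_exp 0 (r + (x 0 i - x0 0 i))))); split.
- move=> k; apply: Ck_on_prod => [|i]; first exact: openT.
  apply: (Ck_onM openT (Ck_on_cst _ _ _)).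
  have Cd : Ck_on k setT (fun x : 'rV[R]_n => x 0 i - x0 0 i : R).
    apply: (Ck_onD openT _ (Ck_on_cst _ _ _)).
    exact: (Ck_on_coord (F := id) _ openT (Ck_on_id _ _)).
  apply: (Ck_onM openT).
    apply: (Ck_on_comp (g := flat_exp 0) openT (U' := setT)) => //.
      apply: (Ck_onD openT (Ck_on_cst _ _ _)).
      exact: (Ck_onM openT (Ck_on_cst _ _ _)).
    exact: Ck_on_flat_exp.
  apply: (Ck_on_comp (g := flat_exp 0) openT (U' := setT)) => //.
    exact: (Ck_onD openT (Ck_on_cst _ _ _)).
  exact: Ck_on_flat_exp.
- rewrite big1// => i _; rewrite subrr mulr0 addr0 /c.
  by rewrite -expr2 mulVf// expf_neq0// gt_eqF.
- move=> x /prodf_neq0 H i; move: (H i isT).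
  rewrite !mulf_eq0 !negb_or => /and3P[_].
  rewrite /flat_exp; case: ltrP; rewrite ?eqxx// => h1 _.
  case: ltrP; rewrite ?eqxx// => h2 _.
  by rewrite ltr_norml; apply/andP; split; lra.
Qed.

End Bump.

(** * Charts and local representatives *)

(** Chain rule in the form suited to charts: a composite passing through an intermediate chart
    agrees with the intended map H only near x. *)
Lemma near_eq_diff_comp (R : realType) (V W Z : normedModType R)
    (G : W -> Z) (F : V -> W) (H : V -> Z) (x : V) (y : W) :
  differentiable F x -> F x = y -> differentiable G y ->
  (\near x, G (F x) = H x) ->
  forall v, 'd H x v = 'd G y ('d F x v).
Proof.
move=> dF <- dG GFH v; rewrite (near_eq_diff GFH (differentiable_comp dF dG)).2.
by rewrite (diff_comp dF dG).
Qed.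

Section Charts.
Context {R : realType} {n : nat}.

Lemma chart_img_fwd (T : topologicalType) (c : chart R n T) p :
  chart_dom c p -> chart_img c (chart_fwd c p).
Proof. by move=> cp; exists p. Qed.

(** Turns an image into a preimage under [chart_bwd], so that openness follows from continuity of
    the inverse chart. *)
Lemma image_chart_fwdE (T : topologicalType) (c : chart R n T) (A : set T) :
  chart_fwd c @` (chart_dom c `&` A) = chart_img c `&` chart_bwd c @^-1` A.
Proof.
apply/seteqP; split=> x.
  by move=> [p [cp Ap] <-]; split; [exact: chart_img_fwd|rewrite /= chart_fwdK].
by move=> [[p cp <-]]; rewrite /= chart_fwdK// => Ap; exists p.
Qed.

Lemma open_image_chart_fwd (T : topologicalType) (c : chart R n T)
    (A : set T) : open A -> open (chart_fwd c @` (chart_dom c `&` A)).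
Proof.
move=> oA; rewrite image_chart_fwdE openE => x [cx Ax]; apply: filterI.
  exact: open_nbhs_nbhs (conj (@chart_img_open _ _ _ c) cx).
by apply: (chart_bwd_continuous cx); exact: open_nbhs_nbhs (conj oA Ax).
Qed.

Lemma open_chart_preimage (T : topologicalType) (c : chart R n T)
    (U : set 'rV[R]_n) : open U -> open (chart_dom c `&` chart_fwd c @^-1` U).
Proof.
move=> oU; rewrite openE => p [cp Up]; apply: filterI.
  exact: open_nbhs_nbhs (conj (@chart_dom_open _ _ _ c) cp).
by apply: (chart_fwd_continuous cp); exact: open_nbhs_nbhs (conj oU Up).
Qed.

End Charts.

Section Local_representatives.
Context {R : realType} {m n : nat} {M : manifold R m} {N : manifold R n}.
Context (f : M -> N) (smooth_f : smooth_map f).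

Definition local_rep (c : chart R m M) (d : chart R n N) :
    'rV[R]_m -> 'rV[R]_n :=
  chart_fwd d \o f \o chart_bwd c.

Definition local_rep_dom (c : chart R m M) (d : chart R n N) :
    set 'rV[R]_m :=
  chart_fwd c @` (chart_dom c `&` f @^-1` chart_dom d).

Lemma open_local_rep_dom c d : open (local_rep_dom c d).
Proof.
apply: open_image_chart_fwd; apply: open_comp (@chart_dom_open _ _ _ d) => p _.
exact: smooth_f.1.
Qed.

Lemma local_rep_dom_fwd c d p : chart_dom c p -> chart_dom d (f p) ->
  local_rep_dom c d (chart_fwd c p).
Proof. by move=> cp dfp; exists p. Qed.

Lemma differentiable_local_rep c d p : atlas M c -> atlas N d ->
  chart_dom c p -> chart_dom d (f p) ->
  differentiable (local_rep c d) (chart_fwd c p).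
Proof.
move=> Mc Nd cp dfp; have [+ _] := smooth_f.2 c d Mc Nd 1%N.
by apply; exact: local_rep_dom_fwd.
Qed.

End Local_representatives.

Arguments open_local_rep_dom {R m n M N f} smooth_f c d.

Section Transition.
Context {R : realType} {n : nat} {M : manifold R n}.
Implicit Types c d e : chart R n M.

(** Transition maps are the local representatives of the identity, so the lemmas on smooth maps
    apply to them. *)
Lemma smooth_map_id : smooth_map (id : M -> M).
Proof. by split=> [p|c d]; [exact: cvg_id|exact: atlas_compatible]. Qed.

Lemma chart_diff_scale c d p a v :
  chart_diff c d p (a *: v) = a *: chart_diff c d p v.
Proof. exact: linearZ. Qed.

Lemma chart_diff0 c d p : chart_diff c d p 0 = 0.
Proof. exact: linear0. Qed.

Lemma chart_diff_id c p v : chart_dom c p -> chart_diff c c p v = v.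
Proof.
move=> cp; rewrite /chart_diff.
have idE : \forall x \near chart_fwd c p,
    id x = (chart_fwd c \o chart_bwd c) x.
  apply: (open_near_eq (@chart_img_open _ _ _ c)); first exact: chart_img_fwd.
  by move=> x [q cq <-]; rewrite /= chart_fwdK.
have -> := (near_eq_diff idE (@ex_diff _ _ _ _ _ _ _ (is_diff_id _))).2.
by rewrite (@diff_val _ _ _ _ _ _ _ (is_diff_id _)).
Qed.

End Transition.

Section Chain.
Context {R : realType} {m n : nat} {M : manifold R m} {N : manifold R n}.
Context (f : M -> N) (smooth_f : smooth_map f).

Lemma diff_local_rep_source c c' d p v :
  atlas M c -> atlas M c' -> atlas N d ->
  chart_dom c p -> chart_dom c' p -> chart_dom d (f p) ->
  'd (local_rep f c' d) (chart_fwd c' p) (chart_diff c c' p v) =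
  'd (local_rep f c d) (chart_fwd c p) v.
Proof.
move=> Mc Mc' Nd cp c'p dfp; apply/esym.
apply: (near_eq_diff_comp (F := chart_fwd c' \o chart_bwd c)).
- exact: (differentiable_local_rep smooth_map_id Mc Mc' cp c'p).
- by rewrite /= chart_fwdK.
- exact: differentiable_local_rep.
- have oA := open_local_rep_dom smooth_map_id c c'.
  apply: (open_near_eq oA); first exact: (local_rep_dom_fwd (f := id)).
  by move=> x [q [cq c'q] <-]; rewrite /local_rep /= !chart_fwdK.
Qed.

Lemma diff_local_rep_target c d d' p v :
  atlas M c -> atlas N d -> atlas N d' ->
  chart_dom c p -> chart_dom d (f p) -> chart_dom d' (f p) ->
  chart_diff d d' (f p) ('d (local_rep f c d) (chart_fwd c p) v) =
  'd (local_rep f c d') (chart_fwd c p) v.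
Proof.
move=> Mc Nd Nd' cp dfp d'fp; apply/esym.
apply: (near_eq_diff_comp (G := chart_fwd d' \o chart_bwd d)).
- exact: differentiable_local_rep.
- by rewrite /local_rep /= chart_fwdK.
- exact: (differentiable_local_rep smooth_map_id Nd Nd' dfp d'fp).
- have oA := open_local_rep_dom smooth_f c d.
  apply: (open_near_eq oA); first exact: local_rep_dom_fwd.
  by move=> x [q [cq dq] <-]; rewrite /local_rep /= !chart_fwdK.
Qed.

(** [tangent_map] uses the distinguished charts, which may change abruptly with p. Here it is
    computed in fixed charts c and d, as is needed when p varies. *)
Lemma tangent_map_chart_diff c d p v :
  atlas M c -> atlas N d -> chart_dom c p -> chart_dom d (f p) ->
  tangent_map f p (chart_diff c (chart_at p) p v) =
  chart_diff d (chart_at (f p)) (f p) ('d (local_rep f c d) (chart_fwd c p) v).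
Proof.
move=> Mc Nd cp dfp.
have Mp := chart_at_atlas p; have Nfp := chart_at_atlas (f p).
have pp := chart_at_dom p; have fpp := chart_at_dom (f p).
by rewrite diff_local_rep_target// -(diff_local_rep_source v Mc Mp Nfp).
Qed.

End Chain.

Lemma chart_diff_comp (R : realType) (n : nat) (M : manifold R n)
    (c d e : chart R n M) p v : atlas M c -> atlas M d -> atlas M e ->
  chart_dom c p -> chart_dom d p -> chart_dom e p ->
  chart_diff d e p (chart_diff c d p v) = chart_diff c e p v.
Proof.
move=> Mc Md Me cp dp ep.
exact: (diff_local_rep_source smooth_map_id v Mc Md Me).
Qed.

(** * Extension of tangent vectors to vector fields *)

Section Bump_field.
Context {R : realType} {n : nat} {M : manifold R n} (p0 : M).
Context (U : set 'rV[R]_n) (Y : 'rV[R]_n -> 'rV[R]_n) (phi : 'rV[R]_n -> R).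
Let c0 := chart_at p0.
Let x0 := chart_fwd c0 p0.

(** The field with components phi Y in the fixed chart [c0], converted at each q to the components
    in [chart_at q], and extended by 0. *)
Definition bump_field_val (q : M) : 'rV[R]_n :=
  if `[< chart_dom c0 q /\ U (chart_fwd c0 q) >]
  then phi (chart_fwd c0 q) *:
       chart_diff c0 (chart_at q) q (Y (chart_fwd c0 q))
  else 0.

Context (r : R) (oU : open U).
Context (rU : forall x : 'rV[R]_n, (forall i, `|x 0 i - x0 0 i| <= r) -> U x).
Context (Uc0 : U `<=` chart_img c0).
Context (smoothY : smooth_on U Y) (smooth_phi : smooth_on setT phi).
Context (supp_phi : forall x : 'rV[R]_n,
  phi x != 0 -> forall i, `|x 0 i - x0 0 i| < r).

Let K : set 'rV[R]_n := [set x | forall i, `|x 0 i - x0 0 i| <= r].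

(** The box K is compact and so is its image in M, which is closed since M is Hausdorff. Extension
    by 0 is smooth for this reason. *)
Lemma closed_bump_support : closed (chart_bwd c0 @` K).
Proof.
apply: (compact_closed (@manifold_hausdorff _ _ M)).
apply: continuous_compact.
  apply: continuous_in_subspaceT => x; rewrite inE => Kx.
  by apply: chart_bwd_continuous; apply: Uc0; exact: rU.
have KE : K = [set x : 'rV[R]_n |
    forall i, `[x0 0 i - r, x0 0 i + r]%classic (x ord0 i)].
  by apply/seteqP; split=> x Kx i; have := Kx i; rewrite /= ?in_itv/= ler_distl.
rewrite KE.
apply: (@rV_compact R n (fun i => `[x0 0 i - r, x0 0 i + r]%classic)).
by move=> i; exact: segment_compact.
Qed.

Lemma smooth_bump_field c : atlas M c ->
  smooth_on (chart_img c)
    (fun x => let p := chart_bwd c x in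
              chart_diff (chart_at p) c p (bump_field_val p)).
Proof.
move=> Mc k; have Mc0 := chart_at_atlas p0.
apply: Ck_on_local => _ [p cp <-].
(* Two open sets cover M: the complement of the closed box, where the field is 0, and the part of
   the domain of [c0] lying over U, where the field is phi Y. *)
have [Kp|Kp] := pselect ((chart_bwd c0 @` K) p); last first.
  have oA := open_image_chart_fwd (c := c) (closed_openC closed_bump_support).
  exists (chart_fwd c @` (chart_dom c `&` ~` (chart_bwd c0 @` K))).
    by exists p.
  apply: Ck_on_eq oA _ (Ck_on_cst k _ 0) => x [q [cq Kq] <-] /=.
  rewrite chart_fwdK// /bump_field_val.
  case: asboolP => [[c0q Uq]|_]; last by rewrite chart_diff0.
  suff -> : phi (chart_fwd c0 q) = 0 by rewrite scale0r chart_diff0.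
  apply/eqP; apply: contra_notT Kq => /supp_phi Kq.
  by exists (chart_fwd c0 q); [move=> i; exact: ltW|rewrite chart_fwdK].
pose A := chart_dom c0 `&` chart_fwd c0 @^-1` U.
have oA := open_image_chart_fwd (c := c) (open_chart_preimage c0 oU).
exists (chart_fwd c @` (chart_dom c `&` A)).
  exists p => //; split=> //; case: Kp => x /rU Ux <-.
  by have [q c0q qx] := Uc0 Ux; split; rewrite /= -qx chart_fwdK// qx.
pose tau := chart_fwd c \o chart_bwd c0.
pose psi := chart_fwd c0 \o chart_bwd c.
pose O := chart_fwd c0 @` (chart_dom c0 `&` chart_dom c).
(* The j-th component in c of the field phi Y, as a function of the coordinates in [c0]; composing
   with psi expresses it in the coordinates of c. *)
pose G j (y : 'rV[R]_n) := phi y * \sum_i Y y 0 i * ('D_('e_i) tau y) 0 j.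
have oO : open O := open_image_chart_fwd (@chart_dom_open _ _ _ c).
have smooth_tau : smooth_on O tau := atlas_compatible Mc0 Mc.
have smooth_psi := atlas_compatible Mc Mc0.
have oUO : open (U `&` O) := openI oU oO.
have CG j : Ck_on k (U `&` O) (G j).
  apply: Ck_onM => //; first exact: Ck_on_sub (smooth_phi k).
  apply: Ck_on_sum => // i; apply: Ck_onM => //.
    by apply: Ck_on_coord => //; exact: Ck_on_sub (smoothY k).
  by apply: Ck_on_coord => //; apply: Ck_on_sub ((smooth_tau k.+1).2 _).
have Cpsi : Ck_on k (chart_fwd c @` (chart_dom c `&` A)) psi.
  apply: Ck_on_sub (smooth_psi k) => _ [q [cq [c0q _]] <-].
  by exists q.
apply: (Ck_on_eq (f := fun x => \row_j (G j \o psi) x)) => //.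
  move=> _ [q [cq [c0q Uq]] <-]; apply/rowP => j; rewrite mxE /=.
  rewrite /psi /= chart_fwdK// /bump_field_val asboolT//.
  have qq := chart_at_dom q; have Mq := chart_at_atlas q.
  rewrite chart_diff_scale (chart_diff_comp _ Mc0 Mq Mc)// mxE; congr (_ * _).
  rewrite [in RHS](row_sum_delta (Y _)) /chart_diff linear_sum summxE.
  apply: eq_bigr => i _; rewrite linearZ mxE deriveE//.
  by apply: (smooth_tau 1%N).1; exists q.
apply: Ck_on_rV => // j; rewrite (_ : (fun x => _) = G j \o psi); last first.
  by apply/funext => x; rewrite mxE.
apply: Ck_on_comp_rV (CG j) => // _ [q [cq [c0q Uq]] <-].
by rewrite /psi /= chart_fwdK//; split => //; exists q.
Qed.

Definition bump_field := VectorField smooth_bump_field.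

End Bump_field.

(** The second conclusion serves to transfer pointwise linear conditions, such as verticality, from
    the local field Y to X. *)
Lemma vector_field_extension (R : realType) (n : nat) (M : manifold R n)
    (p0 : M) (c0 := chart_at p0) (U : set 'rV[R]_n)
    (Y : 'rV[R]_n -> 'rV[R]_n) :
  open U -> U (chart_fwd c0 p0) -> U `<=` chart_img c0 -> smooth_on U Y ->
  exists2 X : vector_field M, X p0 = Y (chart_fwd c0 p0) &
  forall q, X q = 0 \/ exists a, [/\ chart_dom c0 q, U (chart_fwd c0 q) &
    X q = a *: chart_diff c0 (chart_at q) q (Y (chart_fwd c0 q))].
Proof.
move=> oU Ux Uc0 sY.
have /nbhs_ballP[r r0 rU] := open_nbhs_nbhs (conj oU Ux).
(* Halving r fits a closed box inside the open ball contained in U. *)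
have rU2 (x : 'rV[R]_n) :
    (forall i, `|x 0 i - (chart_fwd c0 p0) 0 i| <= r / 2) -> U x.
  move=> xr; apply: rU; split=> // i j; rewrite ord1 /ball /= distrC.
  by apply: le_lt_trans (xr j) _; rewrite ltr_pdivrMr// ltr_pMr// ltr1n.
have [phi [sphi phi1 supp]] :=
  smooth_bump (chart_fwd c0 p0) (divr_gt0 r0 (ltr0Sn R 1)).
exists (bump_field oU rU2 Uc0 sY sphi supp) => /=.
  have cp := chart_at_dom p0.
  by rewrite /bump_field_val asboolT// phi1 scale1r chart_diff_id.
move=> q; rewrite /bump_field_val; case: asboolP => [[c0q Uq]|_]; last by left.
by right; exists (phi (chart_fwd c0 q)).
Qed.

Lemma tangent_vector_extension (R : realType) (n : nat) (M : manifold R n)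
    (p : M) (u : 'rV[R]_n) : exists X : vector_field M, X p = u.
Proof.
have [X Xp _] := vector_field_extension (p0 := p) (Y := fun=> u)
  (@chart_img_open _ _ _ (chart_at p)) (chart_img_fwd (chart_at_dom p))
  (@subset_refl _ _) (fun k => Ck_on_cst k _ u).
by exists X.
Qed.

(** * Smooth matrices and extension of vertical vectors *)

Section Smooth_matrices.
Context {R : realType} {V : normedModType R}.
Implicit Types (U : set V) (k : nat).

Definition mx_Ck_on k U (a b : nat) (A : V -> 'M[R]_(a, b)) :=
  forall i j, Ck_on k U (fun x => A x i j : R).

Lemma mx_Ck_on_cst k U a b (A : 'M[R]_(a, b)) : mx_Ck_on k U (fun=> A).
Proof. by move=> i j; exact: Ck_on_cst. Qed.

Lemma mx_Ck_on_mul k U a b c (A : V -> 'M[R]_(a, b)) (B : V -> 'M[R]_(b, c)) :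
  open U -> mx_Ck_on k U A -> mx_Ck_on k U B ->
  mx_Ck_on k U (fun x => A x *m B x).
Proof.
move=> oU CA CB i j; under eq_fun do rewrite mxE.
by apply: Ck_on_sum => // l; exact: Ck_onM.
Qed.

Lemma Ck_on_det k U a (A : V -> 'M[R]_a) :
  open U -> mx_Ck_on k U A -> Ck_on k U (fun x => \det (A x)).
Proof.
move=> oU CA; apply: Ck_on_sum => // s; apply: Ck_onM => //.
  exact: Ck_on_cst.
exact: Ck_on_prod.
Qed.

Lemma mx_Ck_on_adj k U a (A : V -> 'M[R]_a) :
  open U -> mx_Ck_on k U A -> mx_Ck_on k U (fun x => \adj (A x)).
Proof.
move=> oU CA i j; under eq_fun do rewrite mxE.
apply: Ck_onM => //; first exact: Ck_on_cst.
by apply: Ck_on_det => // i' j'; under eq_fun do rewrite !mxE.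
Qed.

End Smooth_matrices.

(** The constant field u in a chart is corrected to lie in the kernel of the Jacobian J near p, and
    then cut off by a bump function, which preserves verticality. *)
Lemma vertical_vector_extension (R : realType) (m n : nat)
    (M : manifold R m) (N : manifold R n) (f : M -> N) (p : M) (u : 'rV[R]_m) :
  smooth_map f -> \rank (lin1_mx (tangent_map f p)) = n -> vertical f p u ->
  exists2 X : vector_field M, X p = u & forall q, vertical f q (X q).
Proof.
move=> sf rk_p vert_u.
pose c := chart_at p; pose d := chart_at (f p); pose F := local_rep f c d.
have Mc : atlas M c := chart_at_atlas p.
have Nd : atlas N d := chart_at_atlas (f p).
have cp : chart_dom c p := chart_at_dom p.
have dfp : chart_dom d (f p) := chart_at_dom (f p).
pose U := local_rep_dom f c d.
have oU : open U := open_local_rep_dom sf c d.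
have sF : smooth_on U F := sf.2 c d Mc Nd.
pose J x : 'M[R]_(m, n) := \matrix_(i, j) ('D_('e_i) F x) 0 j.
have JE x v : U x -> v *m J x = 'd F x v.
  move=> Ux; have dF := (sF 1%N).1 x Ux.
  rewrite [in RHS](row_sum_delta v) linear_sum mulmx_sum_row.
  apply: eq_bigr => i _; rewrite linearZ; congr (_ *: _).
  by apply/rowP => j; rewrite !mxE (deriveE _ dF).
have Up : U (chart_fwd c p) by exists p.
(* Row vectors multiply J from the left, so surjectivity at p gives A with A J = 1 there. Hence D =
   1 at p and, as u J = 0 there, Y takes the value u. *)
have /row_fullP[A AJ] : row_full (J (chart_fwd c p)).
  rewrite /row_full -{2}rk_p (_ : lin1_mx _ = J (chart_fwd c p)) ?rk_p//.
  by apply/row_matrixP => i; rewrite !rowE JE// mul_rV_lin1.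
have uJ : u *m J (chart_fwd c p) = 0 by rewrite JE.
(* Y is polynomial in J, hence smooth without inverting D, and Y x *m J x = 0
   because \adj (D x) *m D x = (\det (D x))%:M. *)
pose D x := A *m J x.
pose Y x := \det (D x) *: u - u *m J x *m \adj (D x) *m A.
have CJ k : mx_Ck_on k U J.
  move=> i j; under eq_fun do rewrite mxE.
  by apply: Ck_on_coord => //; exact: (sF k.+1).2.
have CD k : mx_Ck_on k U D.
  by apply: mx_Ck_on_mul => //; exact: mx_Ck_on_cst.
have sY : smooth_on U Y.
  move=> k; apply: Ck_on_rV => // i.
  have -> : (fun x => Y x 0 i) = (fun x => \det (D x) * u 0 i +
      (u *m J x *m \adj (D x) *m (- A)) 0 i).
    by apply/funext => x; rewrite mulmxN !mxE.
  apply: Ck_onD => //.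
    by apply: Ck_onM => //; [exact: Ck_on_det|exact: Ck_on_cst].
  apply: mx_Ck_on_mul => //; last exact: mx_Ck_on_cst.
  apply: mx_Ck_on_mul => //; last exact: mx_Ck_on_adj.
  by apply: mx_Ck_on_mul => //; exact: mx_Ck_on_cst.
have YJ x : Y x *m J x = 0.
  rewrite mulmxBl -scalemxAl -(mulmxA _ A) -/(D x) -(mulmxA _ (\adj _)).
  by rewrite mul_adj_mx mul_mx_scalar subrr.
have Uc : U `<=` chart_img c by move=> _ [q [cq _] <-]; exact: chart_img_fwd.
have [X Xp XE] := vector_field_extension oU Up Uc sY.
exists X; first by rewrite Xp /Y uJ !mul0mx /D AJ det1 scale1r subr0.
move=> q; rewrite /vertical /=; have [->|[a [cq Uq ->]]] := XE q.
  exact: linear0.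
have dfq : chart_dom d (f q).
  case: Uq => q' [cq' dfq'] /(congr1 (chart_bwd c)).
  by rewrite !chart_fwdK// => <-.
rewrite /tangent_map linearZ -/(tangent_map f q _).
rewrite (tangent_map_chart_diff sf _ Mc Nd)// -JE// YJ.
rewrite chart_diff0; exact: scaler0.
Qed.

(** * Dual frames and orthogonal projections *)

Section Metric_algebra.
Context {R : realType} {n : nat} {M : manifold R n}.
Implicit Types (g : riemannian_metric M) (p : M) (u v w : 'rV[R]_n).

Lemma metric0l g p w : g p 0 w = 0.
Proof.
have := metric_linear g p 1 0 0 w; rewrite scaler0 addr0 mul1r.
by move/eqP; rewrite -subr_eq0 opprD addrA subrr sub0r oppr_eq0 => /eqP.
Qed.

Lemma metricDl g p u v w : g p (u + v) w = g p u w + g p v w.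
Proof. by rewrite -[u]scale1r metric_linear mul1r scale1r. Qed.

Lemma metricZl g p a u w : g p (a *: u) w = a * g p u w.
Proof. by rewrite -[a *: u]addr0 metric_linear metric0l addr0. Qed.

Lemma metricBl g p u v w : g p (u - v) w = g p u w - g p v w.
Proof. by rewrite -scaleN1r metricDl metricZl mulN1r. Qed.

Lemma metric_suml g p (I : Type) (r : seq I) (c : I -> R)
    (b : I -> 'rV[R]_n) w :
  g p (\sum_(i <- r) c i *: b i) w = \sum_(i <- r) c i * g p (b i) w.
Proof.
elim: r => [|i r IHr]; first by rewrite !big_nil metric0l.
by rewrite !big_cons metric_linear IHr.
Qed.

Lemma metricBr g p u v w : g p w (u - v) = g p w u - g p w v.
Proof. by rewrite Defs.metric_sym metricBl !(Defs.metric_sym g p w). Qed.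

Lemma metric_sumr g p (I : Type) (r : seq I) (c : I -> R)
    (b : I -> 'rV[R]_n) w :
  g p w (\sum_(i <- r) c i *: b i) = \sum_(i <- r) c i * g p w (b i).
Proof.
rewrite Defs.metric_sym metric_suml.
by apply: eq_bigr => i _; rewrite Defs.metric_sym.
Qed.

Lemma metric_eq0 g p u : g p u u = 0 -> u = 0.
Proof.
by move=> gu; apply: contra_eq gu => /(metric_pos g p) gu; rewrite gt_eqF.
Qed.

(** Two candidates differ by a vector of W orthogonal to W, which is 0 by positivity; so [xget] can
    only return w. *)
Lemma orth_projE g p (W : set 'rV[R]_n) u w :
  (forall x y, W x -> W y -> W (x - y)) -> W w -> orthogonal_to g p W (u - w) ->
  orth_proj g p W u = w.
Proof.
move=> WB Ww ow; apply: xget_subset1 => // x y [Wx ox] [Wy oy].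
apply/subr0_eq/(metric_eq0 (g := g) (p := p)).
have : g p ((u - y) - (u - x)) (x - y) = 0.
  by rewrite metricBl ox ?oy ?subrr//; exact: WB.
by rewrite opprB addrC subrKA.
Qed.

Lemma orthogonal_toB g p (W : set 'rV[R]_n) x y :
  orthogonal_to g p W x -> orthogonal_to g p W y -> orthogonal_to g p W (x - y).
Proof. by move=> ox oy v Wv; rewrite metricBl ox// oy// subrr. Qed.

Definition gram_mx g p : 'M[R]_n := \matrix_(i, j) g p 'e_i 'e_j.

Lemma metric_gram g p u v : g p u v = (u *m gram_mx g p *m v^T) 0 0.
Proof.
rewrite [in LHS](row_sum_delta u) metric_suml.
have gE i : g p 'e_i v = \sum_j v 0 j * g p 'e_i 'e_j.
  by rewrite [in LHS](row_sum_delta v) metric_sumr.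
under eq_bigr do rewrite gE mulr_sumr.
rewrite exchange_big mxE; apply: eq_bigr => j _ /=.
rewrite !mxE mulr_suml; apply: eq_bigr => i _.
by rewrite !mxE; ring.
Qed.

Lemma tr_gram_mx g p : (gram_mx g p)^T = gram_mx g p.
Proof. by apply/matrixP => i j; rewrite !mxE Defs.metric_sym. Qed.

(** Duality is encoded by the two expansion formulas. With two families instead of an orthonormal
    one, b is obtained from a by inverting a Gram matrix, without square roots. *)
Definition dual_frame g p (W : set 'rV[R]_n) r (a b : 'I_r -> 'rV[R]_n) :=
  [/\ forall i, W (a i), forall i, W (b i),
    forall w, W w -> w = \sum_i g p w (a i) *: b i &
    forall w, W w -> w = \sum_i g p w (b i) *: a i].

Lemma dual_frame_exists g p (k : nat) (T : 'M[R]_(n, k)) :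
  exists r (a b : 'I_r -> 'rV[R]_n), dual_frame g p [set w | w *m T = 0] a b.
Proof.
have [r [K [Kfree KT subK]]] : exists r (K : 'M[R]_(r, n)), [/\ row_free K,
    K *m T = 0 & forall w, w *m T = 0 -> (w <= K)%MS].
  exists _, (row_base (kermx T)); split; first exact: row_base_free.
    by apply/sub_kermxP; rewrite eq_row_base.
  by move=> w wT; rewrite eq_row_base; apply/sub_kermxP.
pose S := gram_mx g p; pose G := K *m S *m K^T.
(* G is the Gram matrix of the basis K of the kernel of T. If c G = 0, the vector c K has zero norm,
   so c = 0. *)
have Gunit : G \in unitmx.
  rewrite -row_free_unit; apply: inj_row_free => c cG.
  apply/eqP; rewrite -(mulmx_free_eq0 _ Kfree); apply/eqP.
  apply: (metric_eq0 (g := g) (p := p)); rewrite metric_gram -/S.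
  have -> : c *m K *m S *m (c *m K)^T = c *m G *m c^T.
    by rewrite trmx_mul !mulmxA.
  by rewrite cG mul0mx mxE.
have Gsym : G^T = G by rewrite /G !trmx_mul trmxK tr_gram_mx mulmxA.
pose B := invmx G *m K.
have rowT (X : 'M[R]_(r, n)) i : X *m T = 0 -> row i X *m T = 0.
  by move=> XT; rewrite -row_mul XT row0.
have sumE (X Z : 'M[R]_(r, n)) w :
    \sum_i g p w (row i X) *: row i Z = w *m S *m X^T *m Z.
  rewrite [RHS]mulmx_sum_row; apply: eq_bigr => i _; congr (_ *: _).
  by rewrite metric_gram -/S !mxE; apply: eq_bigr => j _; rewrite !mxE.
exists r, (fun i => row i K), (fun i => row i B); split=> [i|i|w wT|w wT].
- exact: rowT.
- by apply: rowT; rewrite -mulmxA KT mulmx0.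
- have /submxP[c ->] := subK w wT.
  by rewrite sumE -(mulmxA c) -(mulmxA c) -/G mulmxA mulmxK.
- have /submxP[c ->] := subK w wT.
  rewrite sumE trmx_mul trmx_inv Gsym -(mulmxA c) !mulmxA.
  by rewrite -(mulmxA c) -(mulmxA c) -/G mulmxK.
Qed.

End Metric_algebra.

Section Frames.
Context {R : realType} {n : nat} {M : manifold R n}.
Implicit Types (g h : riemannian_metric M) (p : M).

Lemma dual_frame_sym g p W r (a b : 'I_r -> 'rV[R]_n) :
  dual_frame g p W a b -> dual_frame g p W b a.
Proof. by case. Qed.

(** The expansion formulas evaluate the metric on W x W only. This is how one frame serves all the
    metrics of a variation. *)
Lemma dual_frame_agree g h p W r (a b : 'I_r -> 'rV[R]_n) :
  (forall u v, W u -> W v -> h p u v = g p u v) ->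
  dual_frame g p W a b -> dual_frame h p W a b.
Proof.
move=> hg [Wa Wb ab ba]; split=> // w Ww.
- by rewrite {1}(ab w Ww); apply: eq_bigr => i _; rewrite hg.
- by rewrite {1}(ba w Ww); apply: eq_bigr => i _; rewrite hg.
Qed.

Context (W : set 'rV[R]_n) (W0 : W 0).
Context (W_submod : forall c x y, W x -> W y -> W (c *: x + y)).

Lemma submod_sum r (c : 'I_r -> R) (b : 'I_r -> 'rV[R]_n) :
  (forall i, W (b i)) -> W (\sum_i c i *: b i).
Proof.
by move=> Wb; apply: big_rec => // i x _ Wx; exact: W_submod.
Qed.

Lemma submodB x y : W x -> W y -> W (x - y).
Proof. by move=> Wx Wy; rewrite addrC -scaleN1r; exact: W_submod. Qed.

(** Expanding w in W along a, with coefficients g(w, b_i), turns g(u, w) into the sum of g(u, a_i)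
    g(w, b_i), which is what the subtracted term pairs to with w. *)
Lemma orth_proj_residual g p r (a b : 'I_r -> 'rV[R]_n) u :
  dual_frame g p W a b ->
  orthogonal_to g p W (u - \sum_i g p u (a i) *: b i).
Proof.
move=> [Wa Wb ab ba] w Ww; rewrite metricBl metric_suml.
rewrite {1}(ba w Ww) metric_sumr -sumrB big1// => i _.
by rewrite (Defs.metric_sym g p w) mulrC subrr.
Qed.

Lemma orth_proj_frame g p r (a b : 'I_r -> 'rV[R]_n) u :
  dual_frame g p W a b -> orth_proj g p W u = \sum_i g p u (a i) *: b i.
Proof.
move=> ab; apply: orth_projE; first exact: submodB.
  by apply: submod_sum; case: ab.
exact: orth_proj_residual.
Qed.

(** The component of u in W is orthogonal to everything orthogonal to W, so the residual satisfies
    the conditions characterizing the projection onto the orthogonal complement. *)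
Lemma orth_proj_orthogonal g p r (a b : 'I_r -> 'rV[R]_n) u :
  dual_frame g p W a b ->
  orth_proj g p (orthogonal_to g p W) u = u - orth_proj g p W u.
Proof.
move=> ab; rewrite (orth_proj_frame u ab); apply: orth_projE.
- exact: orthogonal_toB.
- exact: orth_proj_residual.
- move=> w ow; rewrite opprB addrC subrK Defs.metric_sym.
  by apply: ow; apply: submod_sum; case: ab.
Qed.

(** The right-hand side is polynomial in values of g on fixed vectors, so it can be differentiated
    in t without differentiating a projection. *)
Lemma metric_orth_proj g p r (a b : 'I_r -> 'rV[R]_n) u v :
  dual_frame g p W a b ->
  g p (u - orth_proj g p W u) (v - orth_proj g p W v) =
  g p u v - \sum_i g p v (a i) * g p u (b i).
Proof.
move=> ab; have [_ Wb _ _] := ab.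
rewrite Defs.metric_sym (orth_proj_frame v ab) (orth_proj_frame u ab) metricBr.
rewrite [X in _ - X](orth_proj_residual v ab); last exact: submod_sum.
rewrite subr0 metricBl metric_suml (Defs.metric_sym g p v); congr (_ - _).
by apply: eq_bigr => i _; rewrite (Defs.metric_sym g p u).
Qed.

End Frames.

(** * Variations *)

Lemma vertical_submod (R : realType) (m n : nat) (M : manifold R m)
    (N : manifold R n) (f : M -> N) p c x y :
  vertical f p x -> vertical f p y -> vertical f p (c *: x + y).
Proof.
rewrite /vertical /= /tangent_map => fx fy.
by rewrite linearP fx fy addr0; exact: scaler0.
Qed.

Lemma vertical0 (R : realType) (m n : nat) (M : manifold R m)
    (N : manifold R n) (f : M -> N) p : vertical f p 0.
Proof. exact: linear0. Qed.

Section Variation.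
Context {R : realType} {m n : nat} {M : manifold R m} {N : manifold R n}.
Context (f : M -> N) (g0 : riemannian_metric M) (gN : riemannian_metric N).
Context (hf : riemannian_submersion f g0 gN).
Context (eps : R) (g : R -> riemannian_metric M).
Context (hg : is_variation f g0 eps g).

(** [Riem] compares metrics on vertical fields only; extending u and v to such fields gives the
    comparison at a point. *)
Lemma variation_vertical t p u v : - eps < t < eps ->
  vertical f p u -> vertical f p v -> g t p u v = g0 p u v.
Proof.
move=> teps fu fv; have [sf rk _] := hf; have [_ gR _ _] := hg.
have [X <- fX] := vertical_vector_extension sf (rk p) fu.
have [Y <- fY] := vertical_vector_extension sf (rk p) fv.
exact: gR.
Qed.

Lemma dual_frame_vertical p : exists r (a b : 'I_r -> 'rV[R]_m),
  forall t, - eps < t < eps -> dual_frame (g t) p (vertical f p) a b.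
Proof.
have [r [a [b ab]]] := dual_frame_exists g0 p (lin1_mx (tangent_map f p)).
exists r, a, b => t teps; apply: (@dual_frame_agree _ _ _ g0).
  by move=> u v; exact: variation_vertical.
rewrite (_ : vertical f p = [set w | w *m lin1_mx (tangent_map f p) = 0])//.
by apply/seteqP; split=> w; rewrite /vertical /= mul_rV_lin1.
Qed.

Lemma is_derive_variation t p u v : - eps < t < eps ->
  is_derive t (1 : R) (fun s => g s p u v) (variation_deriv g t p u v).
Proof.
move=> teps; rewrite /variation_deriv derive1E; apply: derivableP.
pose c := chart_at p; pose x := chart_fwd c p.
have cp : chart_dom c p := chart_at_dom p.
(* In the distinguished chart at p the coordinate fields at p are the canonical basis, so joint
   smoothness of the coefficients in (t, x) can be restricted to fixed x. *)
have coefE s i j : metric_coef (g s) c i j x = g s p 'e_i 'e_j.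
  by rewrite /metric_coef /coord_vector /x chart_fwdK//= !chart_diff_id.
have -> : (fun s => g s p u v) =
    \sum_i \sum_j (fun s => u 0 i * v 0 j * metric_coef (g s) c i j x).
  apply/funext => s; rewrite fct_sumE.
  rewrite [in LHS](row_sum_delta u) metric_suml; apply: eq_bigr => i _.
  rewrite fct_sumE [in LHS](row_sum_delta v) metric_sumr mulr_sumr.
  by apply: eq_bigr => j _; rewrite coefE mulrA.
apply: derivable_sum => i; apply: derivable_sum => j.
apply: derivableM; first exact: derivable_cst.
have [_ _ sg _] := hg.
have dg := (sg c (chart_at_atlas p) i j 1%N).1 (t, x).
apply: diff_derivable.
have dtx : differentiable (fun s : R => (s, x)) t.
  exact: (differentiable_pair (ex_diff) (differentiable_cst x t)).
have {}dg := dg (conj teps (chart_img_fwd cp)).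
exact: (differentiable_comp dtx dg).
Qed.

Lemma variation_deriv_sym t p u v :
  variation_deriv g t p u v = variation_deriv g t p v u.
Proof.
by rewrite /variation_deriv; congr (derive1 _ t); apply/funext => s;
  exact: Defs.metric_sym.
Qed.

Lemma variation_deriv_linear t p c u v w : - eps < t < eps ->
  variation_deriv g t p (c *: u + v) w =
  c * variation_deriv g t p u w + variation_deriv g t p v w.
Proof.
move=> teps; have du := is_derive_variation p u w teps.
have dv := is_derive_variation p v w teps.
rewrite [LHS]derive1E.
rewrite (_ : (fun s => g s p (c *: u + v) w) =
  (c \*: (fun s => g s p u w)) + (fun s => g s p v w)); last first.
  by apply/funext => s; rewrite metric_linear.
exact: derive_val.
Qed.

End Variation.

(** * Derivative of the metric on horizontal parts *)

Section Core.
Context {R : realType} {m n : nat} {M : manifold R m} {N : manifold R n}.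
Context (f : M -> N) (g0 : riemannian_metric M) (gN : riemannian_metric N).
Context (hf : riemannian_submersion f g0 gN).
Context (eps : R) (g : R -> riemannian_metric M).
Context (hg : is_variation f g0 eps g).

Lemma variation_deriv_sumr t p r (c : 'I_r -> R) (b : 'I_r -> 'rV[R]_m) u :
  - eps < t < eps ->
  variation_deriv g t p u (\sum_i c i *: b i) =
  \sum_i c i * variation_deriv g t p u (b i).
Proof.
move=> teps; rewrite variation_deriv_sym.
under [RHS]eq_bigr do rewrite variation_deriv_sym.
elim/big_rec2 : _ => [|i x _ _ <-]; last exact: (variation_deriv_linear hg).
have := variation_deriv_linear hg p 1 0 0 u teps; rewrite scaler0 addr0 mul1r.
by move/eqP; rewrite -subr_eq0 opprD addrA subrr sub0r oppr_eq0 => /eqP.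
Qed.

(** For s near t the value [g s p u v] is the constant [g0 p u v]. *)
Lemma variation_deriv_vertical t p u v : - eps < t < eps ->
  vertical f p u -> vertical f p v -> variation_deriv g t p u v = 0.
Proof.
move=> teps fu fv; rewrite /variation_deriv derive1E.
rewrite (near_eq_derive (g := cst (g0 p u v))) ?derive_cst//.
have : \forall s \near t, s \in `]- eps, eps[.
  by apply: near_in_itvoo; rewrite in_itv.
apply: filterS => s; rewrite in_itv => seps.
exact: (variation_vertical hf hg).
Qed.

Let P t p := vert_proj f (g t) p.

Lemma vertical_vert_proj t p u : - eps < t < eps -> vertical f p (P t p u).
Proof.
move=> teps; have [r [a [b ab]]] := dual_frame_vertical hf hg p.
rewrite /P /vert_proj (orth_proj_frame _ _ _ (ab t teps)).
- apply: submod_sum; [exact: vertical0|exact: vertical_submod|].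
  by case: (ab t teps).
- exact: vertical0.
- exact: vertical_submod.
Qed.

Lemma hor_projE t p u : - eps < t < eps ->
  hor_proj f (g t) p u = u - P t p u.
Proof.
move=> teps; have [r [a [b ab]]] := dual_frame_vertical hf hg p.
apply: orth_proj_orthogonal (ab t teps).
- exact: vertical0.
- exact: vertical_submod.
Qed.

Lemma tangent_map_residual t p u : - eps < t < eps ->
  tangent_map f p (u - P t p u) = tangent_map f p u.
Proof.
move=> teps; have := vertical_vert_proj p u teps; rewrite /vertical /=.
by rewrite /tangent_map linearB => ->; rewrite subr0.
Qed.

Lemma horizontal_residual t p u : - eps < t < eps ->
  horizontal f (g t) p (u - P t p u).
Proof.
move=> teps; have [r [a [b ab]]] := dual_frame_vertical hf hg p.
rewrite /P /vert_proj (orth_proj_frame _ _ _ (ab t teps)).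
- exact: orth_proj_residual (ab t teps).
- exact: vertical0.
- exact: vertical_submod.
Qed.

Lemma vert_proj_horizontal t p u : - eps < t < eps ->
  horizontal f (g t) p u -> P t p u = 0.
Proof.
move=> teps hu; have [r [a [b ab]]] := dual_frame_vertical hf hg p.
rewrite /P /vert_proj (orth_proj_frame _ _ _ (ab t teps)).
- by rewrite big1// => i _; rewrite hu ?scale0r//; case: (ab t teps).
- exact: vertical0.
- exact: vertical_submod.
Qed.

(** Product rule applied to [metric_orth_proj] with a frame independent of s. *)
Lemma is_derive_residual t p u v : - eps < t < eps ->
  is_derive t (1 : R) (fun s => g s p (u - P s p u) (v - P s p v))
    (variation_deriv g t p u v -
     (variation_deriv g t p u (P t p v) + variation_deriv g t p v (P t p u))).
Proof.
move=> teps; have [r [a [b ab]]] := dual_frame_vertical hf hg p.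
have W1 := @vertical_submod R m n M N f p; have W2 := @vertical0 R m n M N f p.
have PE := orth_proj_frame W2 W1 _ (ab t teps).
(* The product rule gives g(v, a_i) B(u, b_i) + g(u, b_i) B(v, a_i). The first terms sum to B(u, P
   v); the second need P u expanded along a, hence the swapped frame. *)
have PE' := orth_proj_frame W2 W1 _ (dual_frame_sym (ab t teps)).
pose A s := \sum_i g s p v (a i) * g s p u (b i).
apply: (near_eq_is_derive (f := (fun s => g s p u v) - (\sum_i
   ((fun s => g s p v (a i)) * (fun s => g s p u (b i)))))).
  have : \forall s \near t, s \in `]- eps, eps[.
    by apply: near_in_itvoo; rewrite in_itv.
  apply: filterS => s; rewrite in_itv => seps.
  rewrite [RHS](metric_orth_proj W2 W1 u v (ab s seps)).
  by rewrite -[LHS]/(_ - _) fct_sumE.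
have D w z := is_derive_variation hg p w z teps.
apply: is_derive_eq; congr (_ - _).
rewrite big_split /= /P /vert_proj (PE v) (PE' u).
by rewrite !variation_deriv_sumr.
Qed.

(** P_H u differs from u by a vertical vector, and B vanishes on pairs of vertical vectors. *)
Lemma variation_deriv_proj t p u v : - eps < t < eps ->
  variation_deriv g t p (hor_proj f (g t) p u) (P t p v) =
  variation_deriv g t p u (P t p v).
Proof.
move=> teps; rewrite hor_projE// addrC -scaleN1r.
rewrite (variation_deriv_linear hg)// variation_deriv_vertical ?mulr0 ?add0r//;
exact: vertical_vert_proj.
Qed.

End Core.

(** * Constancy in t and the equivalence *)

Lemma is_derive0_eq (R : realType) (e : R) (h : R -> R) (x y : R) :
  (forall t, - e < t < e -> is_derive t (1 : R) h 0) ->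
  - e < x < e -> - e < y < e -> h x = h y.
Proof.
move=> dh; wlog xy : x y / x <= y => [H xe ye|/andP[ex xe] /andP[ey ye]].
  by have [xy|/ltW yx] := leP x y; [exact: H|apply/esym; exact: H].
have I t : x <= t <= y -> - e < t < e.
  by move=> /andP[xt ty]; rewrite (lt_le_trans ex xt) (le_lt_trans ty ye).
have dh' t : t \in `]x, y[ -> is_derive t (1 : R) h (cst 0 t).
  by rewrite in_itv/= => /andP[xt ty]; apply: dh; apply: I; rewrite !ltW.
have ch : {within `[x, y], continuous h}.
  apply: continuous_in_subspaceT => t; rewrite inE /= in_itv /= => tI.
  by apply/differentiable_continuous/derivable1_diffP; case: (dh t (I t tI)).
have [c _ /eqP] := MVT_segment xy dh' ch.
by rewrite mul0r subr_eq0 => /eqP.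
Qed.

Theorem theorem3p2 (R : realType) (m n : nat)
    (M : manifold R m) (N : manifold R n) (f : M -> N)
    (g0 : riemannian_metric M) (gN : riemannian_metric N)
    (hf : riemannian_submersion f g0 gN)
    (eps : R) (g : R -> riemannian_metric M) (hg : is_variation f g0 eps g) :
  preserves_submersion f gN eps g <->
  (forall t : R, - eps < t < eps ->
   forall (X Y : vector_field M) (p : M),
     let B := variation_deriv g t p in
     let PV := vert_proj f (g t) p in
     let PH := hor_proj f (g t) p in
     B (X p) (Y p) = B (PH (X p)) (PV (Y p)) + B (PH (Y p)) (PV (X p))).
Proof.
have [sf rk g0N] := hf; have [eps0 _ _ g00] := hg.
have zeps : - eps < 0 < eps by rewrite oppr_lt0 eps0.
split=> [pres t teps X Y p B PV PH|HB t teps].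
  rewrite /B /PV /PH !(variation_deriv_proj hf hg)//.
  have /@derive_val := is_derive_residual hf hg p (X p) (Y p) teps.
  (* Preservation makes the metric on horizontal parts equal, for s near t, to the [gN] product of
     the images of X and Y, which does not depend on s. *)
  rewrite (near_eq_derive (g := cst (gN (f p) (tangent_map f p (X p))
    (tangent_map f p (Y p))))) ?derive_cst.
    by move=> /esym/eqP; rewrite subr_eq0 => /eqP.
  have : \forall s \near t, s \in `]- eps, eps[.
    by apply: near_in_itvoo; rewrite in_itv.
  apply: filterS => s; rewrite in_itv => seps; have [_ _ ->] := pres s seps.
  - by rewrite !(tangent_map_residual hf hg).
  - exact: (horizontal_residual hf hg).
  - exact: (horizontal_residual hf hg).
(* Smoothness and rank do not involve the metric; only the isometry condition on horizontal vectors
   is left. *)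
split=> // p u v hu hv.
have Pu := vert_proj_horizontal hf hg teps hu.
have Pv := vert_proj_horizontal hf hg teps hv.
pose h s := g s p (u - vert_proj f (g s) p u) (v - vert_proj f (g s) p v).
have -> : g t p u v = h t by rewrite /h Pu Pv !subr0.
have -> : h t = h 0.
  apply: (@is_derive0_eq _ eps) => // s seps.
  (* The identity is assumed for vector fields, so u and v are extended to fields. *)
  have [X Xp] := tangent_vector_extension p u.
  have [Y Yp] := tangent_vector_extension p v.
  have := HB s seps X Y p; rewrite /= Xp Yp !(variation_deriv_proj hf hg)//.
  move=> Buv; apply: is_derive_eq (is_derive_residual hf hg p u v seps) _.
  by rewrite Buv subrr.
(* [g 0] and [g0] are only known to have equal values, so horizontality is transferred from one to
   the other pointwise. *)
rewrite /h g00 g0N.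
- by rewrite !(tangent_map_residual hf hg).
- by move=> w fw; rewrite -g00; exact: (horizontal_residual hf hg).
- by move=> w fw; rewrite -g00; exact: (horizontal_residual hf hg).
Qed.
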